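(* Let $R$ be a finitely generated commutative $V$-algebra equipped with the fine bornology. The canonical map $R\to R^\dagger$ extends uniquely to an isomorphism of bornological algebras from the linear growth completion $\overline R^{\mathrm{lg}}$ onto the Monsky–Washnitzer completion $R^\dagger$.
   Context: $V$ is a complete discrete valuation ring with uniformizer $\pi$; $|\pi|=\epsilon\in(0,1)$. A (convex) bornology on a $V$-module is a family of bounded subsets containing finite sets, closed under subsets and finite unions, with the $V$-submodule generated by a bounded set bounded; a bornological algebra has bounded multiplication. The fine bornology consists of all subsets of finitely generated submodules. A bornological $V$-module is complete if bounded $\pi$-adically complete submodules are cofinal among bounded sets and all bounded submodules are $\pi$-adically separated; the completion is the universal bounded map to a complete bornological module. For a bounded $V$-submodule $M$ of a bornological $V$-algebra, ''$\varrho(M)\le1$'' means that for every $r>1$ the set $\sum_{n\ge0}r^{-n}\star M^n$ of finite sums of elements of $\bigcup_n\pi^{\lceil\log_\epsilon r^{-n}\rceil}M^n$ is bounded. The linear growth bornology on a bornological $V$-algebra is the smallest algebra bornology containing the given one in which every bounded $V$-submodule $M$ satisfies $\varrho(M)\le1$; $\overline R^{\mathrm{lg}}$ is the completion of $R$ for it. The Monsky–Washnitzer completion $R^\dagger$ is the subset of the $\pi$-adic completion $\hat R=\varprojlim R/\pi^jR$ of elements $z=\sum_{j\ge0}\pi^jw_j$ with $w_j\in M^{\kappa_j}$, where $M\ni1$ is a finitely generated $V$-submodule of $R$ and $\kappa_j\le c(j+1)$ for a constant $c>0$; a subset of $R^\dagger$ is bounded if all its elements admit such representations with one fixed $M$ and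 $c$. *)

(* Defs.v *)
From HB Require Import structures.
From mathcomp Require Import all_boot all_order all_algebra.
From Stdlib Require Import Reals.
Set Implicit Arguments. Unset Strict Implicit. Unset Printing Implicit Defensive.
Import GRing.Theory.
Local Open Scope ring_scope.

Definition pset (T : Type) := T -> Prop.

Definition is_cdvr (V : idomainType) (pi : V) : Prop :=
  pi != 0 /\ pi \notin GRing.unit /\
  (forall x : V, x != 0 -> exists (u : V) (n : nat),
       u \is a GRing.unit /\ x = u * pi ^+ n) /\
  (forall x : nat -> V, (forall j, exists y, x j.+1 - x j = pi ^+ j * y) ->
     exists l : V, forall j, exists y, l - x j = pi ^+ j * y).

Definition span (V : idomainType) (W : lmodType V) (S : pset W) : pset W :=
  fun x => exists l : seq (V * W),
    (forall p, p \in l -> S p.2) /\ x = \sum_(p <- l) p.1 *: p.2.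

Definition submodule (V : idomainType) (W : lmodType V) (M : pset W) : Prop :=
  M 0 /\ (forall x y, M x -> M y -> M (x + y)) /\
  (forall (a : V) x, M x -> M (a *: x)).

Definition is_bornology (V : idomainType) (W : lmodType V)
    (B : pset (pset W)) : Prop :=
  (forall l : seq W, B (fun x => x \in l)) /\
  (forall S T : pset W, B T -> (forall x, S x -> T x) -> B S) /\
  (forall S T : pset W, B S -> B T -> B (fun x => S x \/ T x)) /\
  (forall S : pset W, B S -> B (span S)).

Definition setmul (V : idomainType) (A : lalgType V) (S T : pset A) : pset A :=
  fun z => exists x y, S x /\ T y /\ z = x * y.

Definition is_alg_bornology (V : idomainType) (A : lalgType V)
    (B : pset (pset A)) : Prop :=
  is_bornology B /\ (forall S T, B S -> B T -> B (setmul S T)).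

Definition fine (V : idomainType) (W : lmodType V) : pset (pset W) :=
  fun S => exists l : seq W, forall x, S x -> span (fun y => y \in l) x.

Definition pimul (V : idomainType) (W : lmodType V) (pi : V) (j : nat)
    (M : pset W) : pset W :=
  fun x => exists m, M m /\ x = pi ^+ j *: m.

Definition padic_complete (V : idomainType) (W : lmodType V) (pi : V)
    (M : pset W) : Prop :=
  forall x : nat -> W, (forall j, M (x j)) ->
    (forall j, pimul pi j M (x j.+1 - x j)) ->
    exists l, M l /\ forall j, pimul pi j M (l - x j).

Definition padic_separated (V : idomainType) (W : lmodType V) (pi : V)
    (M : pset W) : Prop :=
  forall x, (forall j, pimul pi j M x) -> x = 0.

Definition complete_born (V : idomainType) (W : lmodType V) (pi : V)
    (B : pset (pset W)) : Prop :=
  (forall S, B S -> exists M, B M /\ submodule M /\ padic_complete pi M /\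
                              (forall x, S x -> M x)) /\
  (forall M, B M -> submodule M -> padic_separated pi M).

Definition lin (V : idomainType) (W1 W2 : lmodType V) (f : W1 -> W2) : Prop :=
  (forall x y, f (x + y) = f x + f y) /\ (forall (a : V) x, f (a *: x) = a *: f x).

Definition bounded_map (V : idomainType) (W1 W2 : lmodType V)
    (B1 : pset (pset W1)) (B2 : pset (pset W2)) (f : W1 -> W2) : Prop :=
  forall S, B1 S -> B2 (fun y => exists x, S x /\ y = f x).

Definition is_completion (V : idomainType) (pi : V) (W C : lmodType V)
    (BW : pset (pset W)) (BC : pset (pset C)) (j : W -> C) : Prop :=
  is_bornology BC /\ complete_born pi BC /\ lin j /\ bounded_map BW BC j /\
  forall (D : lmodType V) (BD : pset (pset D)),
    is_bornology BD -> complete_born pi BD ->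
    forall f : W -> D, lin f -> bounded_map BW BD f ->
      exists g : C -> D, lin g /\ bounded_map BC BD g /\
        (forall x, g (j x) = f x) /\
        (forall g' : C -> D, lin g' -> bounded_map BC BD g' ->
           (forall x, g' (j x) = f x) -> forall c, g' c = g c).

Definition modpow (V : idomainType) (A : lalgType V) (M : pset A) (n : nat)
    : pset A :=
  span (fun x => exists l : seq A,
          size l = n /\ (forall y, y \in l -> M y) /\ x = \prod_(y <- l) y).

Definition sums (V : idomainType) (W : lmodType V) (S : pset W) : pset W :=
  fun x => exists l : seq W, (forall y, y \in l -> S y) /\ x = \sum_(y <- l) y.

Definition Rceil (x : R) : Z := Z.succ (Z.opp (up (Ropp x))).

Definition lgexp (eps r : R) (n : nat) : nat :=
  Z.to_nat (Rceil (Rdiv (ln (Rinv (pow r n))) (ln eps))).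

Definition rho_le1 (V : idomainType) (pi : V) (eps : R) (A : lalgType V)
    (B : pset (pset A)) (M : pset A) : Prop :=
  forall r : R, Rlt R1 r ->
    B (sums (fun x => exists n : nat, pimul pi (lgexp eps r n) (modpow M n) x)).

Definition lg_born (V : idomainType) (pi : V) (eps : R) (A : lalgType V)
    (B0 : pset (pset A)) : pset (pset A) :=
  fun S => forall B : pset (pset A), is_alg_bornology B ->
    (forall T, B0 T -> B T) ->
    (forall M, B M -> submodule M -> rho_le1 pi eps B M) -> B S.

Definition subalg (V : idomainType) (A : lalgType V) (S : pset A) : Prop :=
  submodule S /\ S 1 /\ (forall x y, S x -> S y -> S (x * y)).

Definition fg_alg (V : idomainType) (A : lalgType V) : Prop :=
  exists l : seq A, forall x (S : pset A), subalg S ->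
    (forall y, y \in l -> S y) -> S x.

Definition rhom (V : idomainType) (A1 A2 : lalgType V) (f : A1 -> A2) : Prop :=
  f 1 = 1 /\ forall x y, f (x * y) = f x * f y.

(** The pi-adic completion \hat A = lim A / pi^j A is represented by
    sequences x : nat -> A (x j standing for its class mod pi^j A),
    with equality hat_eq and compatibility hat_compat; the ring and
    module operations are componentwise. *)
Definition pdiv (V : idomainType) (W : lmodType V) (pi : V) (j : nat) (x : W)
    : Prop := exists y, x = pi ^+ j *: y.

Definition hat_compat (V : idomainType) (W : lmodType V) (pi : V)
    (x : nat -> W) : Prop := forall j, pdiv pi j (x j.+1 - x j).

Definition hat_eq (V : idomainType) (W : lmodType V) (pi : V)
    (x y : nat -> W) : Prop := forall j, pdiv pi j (x j - y j).

Definition hat_of (T : Type) (x : T) : nat -> T := fun _ => x.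

Definition MW_gen (V : idomainType) (A : lalgType V) (M : pset A) : Prop :=
  M 1 /\ exists l : seq A, forall x, M x <-> span (fun y => y \in l) x.

Definition has_MW_rep (V : idomainType) (pi : V) (A : lalgType V)
    (M : pset A) (c : R) (z : nat -> A) : Prop :=
  exists (w : nat -> A) (kappa : nat -> nat),
    (forall j, modpow M (kappa j) (w j)) /\
    (forall j, Rle (INR (kappa j)) (Rmult c (INR j.+1))) /\
    (forall k, pdiv pi k (z k - \sum_(i < k) pi ^+ i *: w i)).

Definition in_MW (V : idomainType) (pi : V) (A : lalgType V) (z : nat -> A)
    : Prop :=
  exists (M : pset A) (c : R), MW_gen M /\ Rlt R0 c /\ has_MW_rep pi M c z.

Definition MW_bounded (V : idomainType) (pi : V) (A : lalgType V)
    (S : pset (nat -> A)) : Prop :=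
  exists (M : pset A) (c : R), MW_gen M /\ Rlt R0 c /\
    forall z, S z -> has_MW_rep pi M c z.

Definition MW_iso (V : idomainType) (pi : V) (A : lalgType V)
    (C : lalgType V) (BC : pset (pset C)) (j : A -> C)
    (phi : C -> nat -> A) : Prop :=
  (forall c, in_MW pi (phi c)) /\
  (forall x, hat_eq pi (phi (j x)) (hat_of x)) /\
  (forall c1 c2, hat_eq pi (phi (c1 + c2)) (fun k => phi c1 k + phi c2 k)) /\
  (forall (a : V) c, hat_eq pi (phi (a *: c)) (fun k => a *: phi c k)) /\
  (forall c1 c2, hat_eq pi (phi (c1 * c2)) (fun k => phi c1 k * phi c2 k)) /\
  hat_eq pi (phi 1) (hat_of 1) /\
  (forall c1 c2, hat_eq pi (phi c1) (phi c2) -> c1 = c2) /\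
  (forall z, in_MW pi z -> exists c, hat_eq pi (phi c) z) /\
  (forall S, BC S -> MW_bounded pi (fun z => exists c, S c /\ z = phi c)) /\
  (forall S : pset (nat -> A), MW_bounded pi S ->
     BC (fun c => exists z, S z /\ hat_eq pi (phi c) z)).

(* Main.v *)
Require Import Defs.
From Stdlib Require Import ZArith Reals Lra ClassicalEpsilon.
From HB Require Import structures.
From mathcomp Require Import all_boot all_order all_algebra.
From mathcomp Require Import zify.
From mathcomp Require Import mpoly.
From mathcomp Require boolp.

(** Write [F n] for the span of the monomials of degree at most [n] in the
    generators of [A], and call a set growth-bounded if it lies in
    [N d = \sum_i pi^i F (d (i + 1))] for some [d]. The linear growth bornology is
    exactly the family of growth-bounded sets, and an element of [A^dagger] is a
    limit of partial sums in one [N d]. Sending such a limit to the limit of the same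
    partial sums in a complete bornological module inverts the map given by the
    universal property, provided it is well defined. The only obstruction is that a
    sequence in [N d] may tend to [0] [pi]-adically in [A] without doing so in any
    [N d'], and it is excluded by an effective division statement: there is a [D]
    such that [x] in [F n] with [x] in [pi^K A] equals [pi^K q] for some [q] in
    [F (n + K D)]. This is the Groebner-basis division algorithm carried out in [A]:
    the pairs (m, k) such that [pi^k m] is, modulo [pi^(k+1) A], a combination of
    [pi^k m'] with [m' < m] are closed under multiplication, hence finitely
    generated by Dickson's lemma, and the finitely many cofactors have bounded
    degree. Torsion in [A] is accounted for by the exponent [k]. *)

Set Implicit Arguments. Unset Strict Implicit. Unset Printing Implicit Defensive.
Import Defs GRing.Theory.
Local Open Scope ring_scope.

(** * Submodules and Dickson's lemma *)

Section LinearMaps.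

Variables (V : idomainType) (W1 W2 : lmodType V) (f : W1 -> W2).
Hypothesis f_lin : lin f.

Lemma linD x y : f (x + y) = f x + f y. Proof. by case: f_lin. Qed.

Lemma linZ a x : f (a *: x) = a *: f x. Proof. by case: f_lin. Qed.

Lemma lin0 : f 0 = 0.
Proof. by rewrite -[in LHS](scale0r (0 : W1)) linZ scale0r. Qed.

Lemma linB x y : f (x - y) = f x - f y.
Proof. by rewrite -scaleN1r linD linZ scaleN1r. Qed.

End LinearMaps.

Section Submodules.

Variables (V : idomainType) (W : lmodType V).
Implicit Types (S T M N : pset W).

Lemma submodD M x y : submodule M -> M x -> M y -> M (x + y).
Proof. by case=> _ [+ _]; apply. Qed.

Lemma submodZ M a x : submodule M -> M x -> M (a *: x).
Proof. by case=> _ [_]; apply. Qed.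

Lemma submodB M x y : submodule M -> M x -> M y -> M (x - y).
Proof. by move=> Msub Mx My; rewrite -scaleN1r; apply: submodD (submodZ _ _ _). Qed.

Lemma submod_sum M (I : Type) (r : seq I) (P : pred I) (f : I -> W) :
  submodule M -> (forall i, P i -> M (f i)) -> M (\sum_(i <- r | P i) f i).
Proof. by move=> [M0 [MD _]] Mf; elim/big_ind: _. Qed.

Lemma submod_sum_seq M (I : eqType) (r : seq I) (f : I -> W) :
  submodule M -> (forall i, i \in r -> M (f i)) -> M (\sum_(i <- r) f i).
Proof. by move=> Msub Mf; rewrite big_seq; apply: submod_sum. Qed.

Lemma mem_span S x : S x -> span S x.
Proof.
move=> Sx; exists [:: (1, x)]; rewrite big_seq1 scale1r; split=> // p.
by rewrite inE => /eqP->.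
Qed.

Lemma submod_span S : submodule (span S).
Proof.
split; first by exists [::]; rewrite big_nil.
split=> [x y [r [rS ->]] [t [tS ->]] | a x [r [rS ->]]].
  exists (r ++ t); rewrite big_cat; split=> // p.
  by rewrite mem_cat => /orP[/rS|/tS].
exists [seq (a * p.1, p.2) | p <- r]; split=> [p /mapP[q /rS Sq ->] //|].
by rewrite big_map scaler_sumr; apply: eq_bigr => p _; rewrite scalerA.
Qed.

Lemma span_min S M x : submodule M -> (forall y, S y -> M y) -> span S x -> M x.
Proof.
move=> Msub SM [r [rS ->]]; apply: submod_sum_seq => // p /rS Sp.
by case: Msub => _ [_ MZ]; apply/MZ/SM.
Qed.

Lemma span_sub S T x : (forall y, S y -> T y) -> span S x -> span T x.
Proof. by move=> ST; apply: span_min (submod_span T) _ => y /ST/mem_span. Qed.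

Lemma submod_sums S M x :
  submodule M -> (forall y, S y -> M y) -> sums S x -> M x.
Proof. by move=> Msub SM [r [rS ->]]; apply: submod_sum_seq => // y /rS/SM. Qed.

Lemma submod_preim (W' : lmodType V) (f : W' -> W) M :
  lin f -> submodule M -> submodule (fun x => M (f x)).
Proof.
move=> f_lin [M0 [MD MZ]]; split; first by rewrite lin0.
by split=> [x y Mx My | a x Mx]; rewrite ?linD ?linZ //; [apply: MD | apply: MZ].
Qed.

Lemma submod_eq0 : submodule (fun x : W => x = 0).
Proof.
by split=> //; split=> [x y -> -> | a x ->]; rewrite ?addr0 ?scaler0.
Qed.

Variable pi : V.

Lemma submod_pimul n M : submodule M -> submodule (pimul pi n M).
Proof.
move=> [M0 [MD MZ]]; split; first by exists 0; rewrite scaler0.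
split=> [_ _ [x [Mx ->]] [y [My ->]] | a _ [x [Mx ->]]].
  by exists (x + y); rewrite scalerDr; split=> //; apply: MD.
by exists (a *: x); rewrite !scalerA mulrC; split=> //; apply: MZ.
Qed.

Lemma pimul_sub n M N x :
  (forall y, M y -> N y) -> pimul pi n M x -> pimul pi n N x.
Proof. by move=> MN [y [/MN Ny ->]]; exists y. Qed.

Lemma pimul_le (m n : nat) M x : submodule M -> (m <= n)%N ->
  pimul pi n M x -> pimul pi m M x.
Proof.
move=> [_ [_ MZ]] le_mn [y [My ->]]; exists (pi ^+ (n - m) *: y).
by split; [apply: MZ | rewrite scalerA -exprD subnKC].
Qed.

Lemma pdiv_scale n (x : W) : pdiv pi n (pi ^+ n *: x). Proof. by exists x. Qed.

Lemma submod_pdiv n : submodule (@pdiv V W pi n).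
Proof.
split; first by exists 0; rewrite scaler0.
split=> [_ _ [x ->] [y ->] | a _ [x ->]]; first by exists (x + y); rewrite scalerDr.
by exists (a *: x); rewrite !scalerA mulrC.
Qed.

Lemma pdiv0 n : pdiv pi n (0 : W). Proof. by case: (submod_pdiv n). Qed.

Lemma pdivD n (x y : W) : pdiv pi n x -> pdiv pi n y -> pdiv pi n (x + y).
Proof. by case: (submod_pdiv n) => _ [+ _]; apply. Qed.

Lemma pdivB n (x y : W) : pdiv pi n x -> pdiv pi n y -> pdiv pi n (x - y).
Proof. exact: submodB (submod_pdiv n). Qed.

Lemma pdivZ n a (x : W) : pdiv pi n x -> pdiv pi n (a *: x).
Proof. by case: (submod_pdiv n) => _ [_]; apply. Qed.

Lemma pdiv_le (m n : nat) (x : W) : (m <= n)%N -> pdiv pi n x -> pdiv pi m x.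
Proof.
move=> le_mn [y ->]; exists (pi ^+ (n - m) *: y).
by rewrite scalerA -exprD subnKC.
Qed.

Lemma pdivC n (x y : W) : pdiv pi n (x - y) -> pdiv pi n (y - x).
Proof. by move=> xy; rewrite -opprB -scaleN1r; apply: pdivZ. Qed.

Lemma pdiv_trans n (x y z : W) :
  pdiv pi n (x - y) -> pdiv pi n (y - z) -> pdiv pi n (x - z).
Proof. by move=> xy yz; rewrite -(subrKA y x); apply: pdivD. Qed.

Lemma hat_eqxx (x : nat -> W) : hat_eq pi x x.
Proof. by move=> k; rewrite subrr; apply: pdiv0. Qed.

Lemma hat_eq_sym (x y : nat -> W) : hat_eq pi x y -> hat_eq pi y x.
Proof. by move=> xy k; apply: pdivC. Qed.

Lemma hat_eq_trans (x y z : nat -> W) :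
  hat_eq pi x y -> hat_eq pi y z -> hat_eq pi x z.
Proof. by move=> xy yz k; apply: pdiv_trans (yz k). Qed.

End Submodules.

Lemma span_mul (V : idomainType) (A : algType V) (S T M : pset A) x y :
  submodule M -> (forall s t, S s -> T t -> M (s * t)) ->
  span S x -> span T y -> M (x * y).
Proof.
move=> [M0 [MD MZ]] STM Sx Ty; pose rmul t := fun s : A => s * t.
have rmul_lin t : lin (rmul t).
  by split=> [s s' | a s]; rewrite /rmul ?mulrDl ?scalerAl.
have lmul_lin s : lin (fun t : A => s * t).
  by split=> [t t' | a t]; rewrite ?mulrDr ?scalerAr.
apply: span_min (submod_preim (lmul_lin x) (conj M0 (conj MD MZ))) _ Ty => t Tt.
apply: span_min (submod_preim (rmul_lin t) (conj M0 (conj MD MZ))) _ Sx => s Ss.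
exact: STM.
Qed.

(** Induction on the number of coordinates. A finite list that dominates in the first [m]
    coordinates also dominates every [x] whose last coordinate is at least the maximum [N] over that
    list; the finitely many smaller values of the last coordinate are treated slice by slice.
    Coordinates are functions on [T], so elements may carry data that is not compared. *)
Lemma dickson (T : eqType) (f : nat -> T -> nat) m (P : T -> Prop) :
  exists l : seq T, (forall y, y \in l -> P y) /\
    forall x, P x -> exists2 y, y \in l & forall i, (i < m)%N -> (f i y <= f i x)%N.
Proof.
elim: m P => [|m IHm] P.
  case: (classic (exists x, P x)) => [[x Px] | noP].
    by exists [:: x]; split=> [y | y Py]; [rewrite inE => /eqP-> | exists x; rewrite ?inE].
  by exists [::]; split=> // x Px; case: noP; exists x.
have [l0 [l0P l0min]] := IHm P.
pose N := (\max_(y <- l0) f m y)%N.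
have /(_ N)[l1 [l1P l1min]]: forall n, exists l1 : seq T,
    (forall y, y \in l1 -> P y) /\ forall x, P x -> (f m x < n)%N ->
    exists2 y, y \in l1 & forall i, (i < m.+1)%N -> (f i y <= f i x)%N.
  elim=> [|n [l1 [l1P l1min]]]; first by exists [::].
  have [l2 [l2P l2min]] := IHm (fun x => P x /\ f m x = n).
  exists (l1 ++ l2); split=> [y | x Px].
    by rewrite mem_cat => /orP[/l1P | /l2P[]].
  rewrite ltnS leq_eqVlt => /orP[/eqP fx | lt_fx].
    have [y l2y yx] := l2min x (conj Px fx).
    exists y => [|i]; first by rewrite mem_cat l2y orbT.
    rewrite ltnS leq_eqVlt => /orP[/eqP-> | /yx //].
    by have [_ ->] := l2P y l2y; rewrite fx.
  by have [y l1y yx] := l1min x Px lt_fx; exists y => //; rewrite mem_cat l1y.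
exists (l0 ++ l1); split=> [y | x Px].
  by rewrite mem_cat => /orP[/l0P | /l1P].
case: (ltnP (f m x) N) => [lt_fx | le_N].
  by have [y l1y yx] := l1min x Px lt_fx; exists y => //; rewrite mem_cat l1y orbT.
have [y l0y yx] := l0min x Px.
exists y => [|i]; first by rewrite mem_cat l0y.
rewrite ltnS leq_eqVlt => /orP[/eqP-> | /yx //].
by apply: leq_trans le_N; apply: (leq_bigmax_seq (F := f m)).
Qed.

(** * Division by powers of the uniformizer *)

Section DegreeFiltration.

Variables (V : idomainType) (A : comAlgType V) (l : seq A).

(** Distinct exponents may have the same value in [A], so degree and order are always taken on
    exponents. *)
Definition monomial (m : 'X_{1..size l}) : A := mmap1 (fun i => l`_i) m.

Definition below (P : pset 'X_{1..size l}) : pset A :=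
  span (fun x => exists2 m, P m & x = monomial m).

Lemma submod_below P : submodule (below P).
Proof. exact: submod_span. Qed.

Definition deg_le (n : nat) : pset A := below (fun m => (mdeg m <= n)%N).

Lemma monomialD m1 m2 : monomial (m1 + m2) = monomial m1 * monomial m2.
Proof. by apply: commr_mmap1_M => i x; rewrite /GRing.comm mulrC. Qed.

Lemma monomial0 : monomial 0%MM = 1. Proof. exact: mmap11. Qed.

Lemma submod_deg_le n : submodule (deg_le n).
Proof. exact: submod_span. Qed.

Lemma deg_le_monomial n m : (mdeg m <= n)%N -> deg_le n (monomial m).
Proof. by move=> le_mn; apply: mem_span; exists m. Qed.

Lemma deg_leW n n' x : (n <= n')%N -> deg_le n x -> deg_le n' x.
Proof.
move=> le_nn'; apply: span_sub => y [m le_mn ->].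
by exists m => //; apply: leq_trans le_nn'.
Qed.

Lemma deg_le1 n : deg_le n 1.
Proof. by rewrite -monomial0; apply: deg_le_monomial; rewrite mdeg0. Qed.

Lemma deg_leM n n' x y : deg_le n x -> deg_le n' y -> deg_le (n + n') (x * y).
Proof.
apply: span_mul (submod_deg_le _) _ => _ _ [m le_mn ->] [m' le_mn' ->].
by rewrite -monomialD; apply: deg_le_monomial; rewrite mdegD leq_add.
Qed.

Lemma deg_le_gen x : x \in l -> deg_le 1 x.
Proof.
move=> lx; have lt_x : (index x l < size l)%N by rewrite index_mem.
rewrite -[x](nth_index 0 lx) -[nth _ _ _]/(l`_(Ordinal lt_x)).
rewrite -(mmap1U (fun i : 'I_(size l) => l`_i)).
by apply: deg_le_monomial; rewrite mdeg1.
Qed.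

Lemma monomial_modpow (m : 'X_{1..size l}) n : (mdeg m <= n)%N ->
  exists s : seq A, size s = n /\ (forall y, y \in s -> y \in 1 :: l) /\
    monomial m = \prod_(y <- s) y.
Proof.
elim: n m => [|n IHn] m le_mn.
  have /eqP-> : m == 0%MM by rewrite -mdeg_eq0 -leqn0.
  by exists [::]; rewrite big_nil monomial0.
case: (boolP (mdeg m <= n)%N) => [/IHn[s [sz [sl ->]]] | ltnm].
  (* Factors [1] pad a monomial of smaller degree to exactly [n.+1] factors. *)
  exists (1 :: s); rewrite big_cons mul1r /= sz; split=> //; split=> // y.
  by rewrite inE => /orP[/eqP-> | /sl //]; rewrite inE eqxx.
have [i mi] : exists i, (0 < m i)%N.
  apply: NNPP => m0; move: ltnm; rewrite mdegE big1 // => i _.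
  by apply/eqP; rewrite -leqn0 leqNgt; apply/negP => mi; case: m0; exists i.
have Um : (U_(i) <= m)%MM.
  by apply/mnm_lepP => k; rewrite mnm1E; case: eqP => // <-.
have /IHn[s [sz [sl ms]]] : (mdeg (m - U_(i))%MM <= n)%N.
  have := le_mn; rewrite -{1}(submK Um) mdegD mdeg1; lia.
exists (l`_i :: s); split; first by rewrite /= sz.
split=> [y|]; first by rewrite inE => /orP[/eqP-> | /sl //]; rewrite inE mem_nth ?orbT.
by rewrite big_cons -ms -[in LHS](submK Um) monomialD mulrC [monomial U_(i)]mmap1U.
Qed.

Lemma deg_le_modpow n x : deg_le n x -> modpow (span (fun y => y \in 1 :: l)) n x.
Proof.
apply: span_sub => y [m /monomial_modpow[s [sz [sl ->]]] ->].
by exists s; split=> //; split=> // z /sl lz; apply: mem_span.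
Qed.

Lemma modpow_deg_le (M : pset A) d n x :
  (forall y, M y -> deg_le d y) -> modpow M n x -> deg_le (d * n) x.
Proof.
move=> Md; apply: span_min (submod_deg_le _) _ => _ [s [<- [sM ->]]].
elim: s sM => [|y s IHs] sM; first by rewrite big_nil; apply: deg_le1.
rewrite big_cons mulnS; apply: deg_leM; first by apply/Md/sM; rewrite mem_head.
by apply: IHs => z sz; apply: sM; rewrite inE sz orbT.
Qed.

Definition generates := forall x (S : pset A), subalg S ->
  (forall y, y \in l -> S y) -> S x.

(** The union of the filtration is a subalgebra that contains the generators. *)
Lemma deg_le_ex x : generates -> exists n, deg_le n x.
Proof.
move=> gen; apply: (gen x (fun y => exists n, deg_le n y)) => [|y ly]; last first.
  by exists 1%N; apply: deg_le_gen.
split.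
  split; first by exists 0%N; case: (submod_deg_le 0).
  split=> [u v [n nu] [n' nv] | a u [n nu]].
    exists (maxn n n'); case: (submod_deg_le (maxn n n')) => _ [FD _].
    by apply: FD; [apply: deg_leW nu | apply: deg_leW nv]; lia.
  by exists n; case: (submod_deg_le n) => _ [_]; apply.
split; first by exists 0%N; apply: deg_le1.
by move=> u v [n nu] [n' nv]; exists (n + n')%N; apply: deg_leM.
Qed.

Lemma deg_le_ex_seq (s : seq A) :
  generates -> exists n, forall x, x \in s -> deg_le n x.
Proof.
move=> gen; elim: s => [|y s [n sn]]; first by exists 0%N.
have [n' ny] := deg_le_ex y gen; exists (maxn n n') => x.
rewrite inE => /orP[/eqP-> | /sn nx]; [apply: deg_leW ny | apply: deg_leW nx]; lia.
Qed.

(** The monomial order is total, so finitely many exponents have a largest one. This supplies the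
    leading exponent for the division algorithm. *)
Lemma below_cases P x : below P x ->
  x = 0 \/ exists2 m, P m & below (fun m' => (m' <= m)%O) x.
Proof.
have below_le m1 m2 y : (m1 <= m2)%O ->
    below (fun m' => (m' <= m1)%O) y -> below (fun m' => (m' <= m2)%O) y.
  move=> le_m; apply: span_sub => _ [m3 le_m3 ->]; exists m3 => //.
  exact: Order.POrderTheory.le_trans le_m3 le_m.
apply: (span_min (M := fun x => x = 0 \/
    exists2 m, P m & below (fun m' => (m' <= m)%O) x)) => [|_ [m Pm ->]]; last first.
  by right; exists m => //; apply: mem_span; exists m.
split; first by left.
split=> [x1 x2 | a x1]; last first.
  case=> [-> | [m Pm x1m]]; first by left; rewrite scaler0.
  by right; exists m => //; case: (submod_below (fun m' => (m' <= m)%O)) => _ [_]; apply.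
case=> [-> | [m1 Pm1 x1m]]; first by rewrite add0r.
case=> [-> | [m2 Pm2 x2m]]; first by rewrite addr0; right; exists m1.
have add3 m3 : P m3 -> (m1 <= m3)%O -> (m2 <= m3)%O ->
    x1 + x2 = 0 \/ exists2 m, P m & below (fun m' => (m' <= m)%O) (x1 + x2).
  move=> Pm3 le1 le2; right; exists m3 => //.
  case: (submod_below (fun m' => (m' <= m3)%O)) => _ [bD _].
  by apply: bD; [apply: below_le x1m | apply: below_le x2m].
case/orP: (Order.TotalTheory.le_total m1 m2) => le12.
  exact: (add3 m2).
exact: (add3 m1).
Qed.

Lemma below_le_split m x : below (fun m' => (m' <= m)%O) x ->
  exists c y, below (fun m' => (m' < m)%O) y /\ x = c *: monomial m + y.
Proof.
have [b0 [bD bZ]] := submod_below (fun m' => (m' < m)%O).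
apply: (span_min (M := fun x => exists c y,
    below (fun m' => (m' < m)%O) y /\ x = c *: monomial m + y)) => [|_ [m' le_m' ->]].
  split; first by exists 0, 0; rewrite scale0r addr0.
  split=> [_ _ [c [y [ym ->]]] [c' [y' [ym' ->]]] | a _ [c [y [ym ->]]]].
    exists (c + c'), (y + y'); rewrite scalerDl addrACA.
    by split=> //; apply: bD.
  by exists (a * c), (a *: y); rewrite scalerDr scalerA; split=> //; apply: bZ.
have [-> | ne_m] := eqVneq m' m.
  by exists 1, 0; rewrite scale1r addr0.
exists 0, (monomial m'); rewrite scale0r add0r; split=> //.
apply: mem_span; exists m' => //.
by rewrite Order.POrderTheory.lt_neqAle ne_m.
Qed.

Variable pi : V.
Hypothesis pi_dvr : forall c : V, c \is a GRing.unit \/ exists c', c = pi * c'.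
Hypothesis gen : generates.

(* [m] is the leading monomial of some monic [p] such that [pi ^+ k * p] vanishes
   modulo [pi ^+ k.+1] in [A]; [e] bounds the degree of the cofactor. *)
Definition leading (t : 'X_{1..size l} * nat * nat) : Prop :=
  let: (m, k, e) := t in exists y b, below (fun m' => (m' < m)%O) y /\
    deg_le e b /\ pi ^+ k *: monomial m = pi ^+ k *: y + pi ^+ k.+1 *: b.

(** Multiply the relation by [monomial m']: the order on exponents is compatible with addition. With
    [leadingW], which multiplies by a power of [pi], the pairs (m, k) form an upward closed set, as
    Dickson's lemma requires. *)
Lemma leading_mul m k e m' : leading (m, k, e) ->
  leading ((m' + m)%MM, k, (mdeg m' + e)%N).
Proof.
move=> [y [b [ym [be Em]]]]; exists (monomial m' * y), (monomial m' * b).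
split; first last.
  split; first by apply: deg_leM => //; apply: deg_le_monomial.
  by rewrite monomialD !scalerAr Em mulrDr.
apply: (span_mul (submod_span _) _ (mem_span (erefl (monomial m')))) ym.
move=> _ _ <- [m2 lt_m2 ->]; rewrite -monomialD; apply: mem_span.
by exists (m' + m2)%MM; rewrite // ltmc_add2r.
Qed.

Lemma leadingW m k k' e : (k <= k')%N -> leading (m, k, e) -> leading (m, k', e).
Proof.
move=> le_k [y [b [ym [be Em]]]]; exists y, b; split=> //; split=> //.
rewrite -(subnK le_k) -addnS !exprD -!scalerA Em.
by rewrite scalerDr.
Qed.

(** [D] is the largest cofactor bound among the finitely many minimal triples; any other relation
    can be replaced by a multiple of a minimal one, which raises the degree by that of the
    multiplier only. *)
Lemma leading_bound : exists D, forall m k e, leading (m, k, e) ->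
  leading (m, k, (mdeg m + D)%N).
Proof.
(* Coordinates below [size l] are the exponents and coordinate [size l] is [k]; the bound [e] is
   carried along without being compared. *)
pose coord i (t : 'X_{1..size l} * nat * nat) :=
  if insub i is Some j then t.1.1 j else t.1.2.
have [s [slead smin]] := dickson coord (size l).+1 leading.
pose D := (\max_(t <- s) t.2)%N; exists D => m k e /smin[[[m0 k0] e0] st le_t].
have le_m : (m0 <= m)%MM.
  apply/mnm_lepP => i; have := le_t i; rewrite /coord valK /=; apply.
  by rewrite ltnS ltnW.
have le_k : (k0 <= k)%N by have := le_t (size l); rewrite /coord insubF ?ltnn //; apply.
have le_e : (e0 <= D)%N by apply: (leq_bigmax_seq (F := snd)) st _.
have := leadingW le_k (leading_mul (m - m0)%MM (slead _ st)).
rewrite submK // => -[y [b [ym [be Em]]]]; exists y, b; split=> //; split=> //.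
by apply: deg_leW be; apply: leq_add => //; apply: mdegB.
Qed.

(** Well-founded induction on the leading exponent. A leading coefficient in [pi V] is divided
    directly; a unit one makes the exponent [leading], so its term can be replaced by lower terms
    and a multiple of [pi ^+ k.+1] of controlled degree. The factor [pi ^+ k] stays on both sides
    because torsion forbids cancelling it. *)
Lemma divide_once : exists D, forall n k x, deg_le n x ->
  pdiv pi k.+1 (pi ^+ k *: x) ->
  exists q, deg_le (n + D) q /\ pi ^+ k *: x = pi ^+ k.+1 *: q.
Proof.
have [D leadD] := leading_bound; exists D => n k x nx.
suff main m : (mdeg m <= n)%N -> forall y, below (fun m' => (m' <= m)%O) y ->
    pdiv pi k.+1 (pi ^+ k *: y) ->
    exists q, deg_le (n + D) q /\ pi ^+ k *: y = pi ^+ k.+1 *: q.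
  case: (below_cases nx) => [-> _ | [m le_mn /main]]; last exact.
  by exists 0; rewrite !scaler0; case: (submod_deg_le (n + D)).
elim/(well_founded_induction (@ltom_wf (size l))): m => m IHm le_mn y ym.
have IHlt z : below (fun m' => (m' < m)%O) z -> pdiv pi k.+1 (pi ^+ k *: z) ->
    exists q, deg_le (n + D) q /\ pi ^+ k *: z = pi ^+ k.+1 *: q.
  case/below_cases => [-> _ | [m' lt_m' zm]].
    by exists 0; rewrite !scaler0; case: (submod_deg_le (n + D)).
  (* The order is graded: a smaller exponent has no larger degree. *)
  apply: (IHm m') => //; apply: leq_trans le_mn.
  by apply/lemc_mdeg/Order.POrderTheory.ltW.
have [_ [FD FZ]] := submod_deg_le (n + D).
have [_ [bD bZ]] := submod_below (fun m' => (m' < m)%O).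
have [c [z [zm ->]]] := below_le_split ym.
rewrite scalerDr; case: (pi_dvr c) => [uc | [c' ->]] dy.
  have [b Eb] := dy.
  have [e be] := deg_le_ex b gen.
  (* Dividing [Eb] by the unit [c] gives a relation whose cofactor has an uncontrolled degree [e];
     [leadD] trades it for a cofactor of degree at most [mdeg m + D]. *)
  have [y0 [b0 [y0m [b0D E0]]]] : leading (m, k, (mdeg m + D)%N).
    apply: leadD (e) _; exists (- c^-1 *: z), (c^-1 *: b); split; first exact: bZ.
    split; first by case: (submod_deg_le e) => _ [_]; apply.
    have -> : pi ^+ k.+1 *: (c^-1 *: b) = c^-1 *: (pi ^+ k.+1 *: b).
      by rewrite !scalerA mulrC.
    have Em : c^-1 *: (pi ^+ k *: (c *: monomial m)) = pi ^+ k *: monomial m.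
      by rewrite !scalerA mulrAC mulVr // mul1r.
    by rewrite -Eb scalerDr Em !scalerA mulrN scaleNr [pi ^+ k * _]mulrC addrCA addNr addr0.
  have {}b0D : deg_le (n + D) b0 by apply: deg_leW b0D; rewrite leq_add2r.
  have Ey : pi ^+ k *: (c *: monomial m) + pi ^+ k *: z =
      pi ^+ k *: (c *: y0 + z) + pi ^+ k.+1 *: (c *: b0).
    rewrite scalerA mulrC -scalerA E0 !scalerDr !scalerA.
    by rewrite addrAC [c * pi ^+ k]mulrC [c * pi ^+ k.+1]mulrC.
  have [|q [qD Eq]] := IHlt (c *: y0 + z) (bD _ _ (bZ c _ y0m) zm).
    rewrite -[X in pdiv _ _ X](addrK (pi ^+ k.+1 *: (c *: b0))) -Ey.
    by apply: pdivB => //; apply: pdiv_scale.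
  exists (q + c *: b0); rewrite Ey Eq scalerDr; split=> //.
  by apply: FD => //; apply: FZ.
have Ec : pi ^+ k *: (pi * c' *: monomial m) = pi ^+ k.+1 *: (c' *: monomial m).
  by rewrite !scalerA mulrA -exprSr.
have [|q [qD Eq]] := IHlt z zm.
  rewrite -[X in pdiv _ _ X](addKr (pi ^+ k *: (pi * c' *: monomial m))) addrC.
  by apply: pdivB => //; rewrite Ec; apply: pdiv_scale.
exists (c' *: monomial m + q); rewrite Ec Eq scalerDr; split=> //.
apply: FD => //; apply/FZ/deg_le_monomial; exact: leq_trans (leq_addr _ _).
Qed.

End DegreeFiltration.

(** * The exponents of the linear growth condition *)

Section GrowthExponents.

Local Open Scope R_scope.

Lemma Rceil_bounds x : x <= IZR (Rceil x) < x + 1.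
Proof.
have [lt_up up_le] := archimed (- x).
by rewrite /Rceil -Z.add_1_r plus_IZR opp_IZR; lra.
Qed.

Lemma Z_to_nat_ge z : IZR z <= INR (Z.to_nat z).
Proof.
case: (Z.lt_ge_cases z 0) => [lt_z0 | le_0z]; last first.
  by rewrite INR_IZR_INZ Z2Nat.id //; lra.
by apply: Rle_trans (pos_INR _); apply: Rlt_le; apply: (IZR_lt z 0).
Qed.

Variable eps : R.
Hypotheses (eps_gt0 : 0 < eps) (eps_lt1 : eps < 1).

Let ln_eps_lt0 : ln eps < 0. Proof. by rewrite -ln_1; apply: ln_increasing. Qed.

Lemma lgexp_arg r n : 1 < r ->
  ln (/ r ^ n) / ln eps = INR n * (ln r / - ln eps).
Proof.
move=> lt1r; rewrite ln_Rinv; last by apply: pow_lt; lra.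
by rewrite ln_pow; [field; lra | lra].
Qed.

(** [lgexp eps r n] is the ceiling of [n * s] with [s = ln r / - ln eps > 0], so any [K] above [/ s]
    works. *)
Lemma lgexp_ge r : 1 < r -> exists K, forall n, (n <= K * lgexp eps r n)%coq_nat.
Proof.
move=> lt1r; pose s := ln r / - ln eps.
have ln_r : 0 < ln r by rewrite -ln_1; apply: ln_increasing; lra.
have s_gt0 : 0 < s by apply: Rdiv_lt_0_compat; lra.
have [K ltK] := INR_unbounded (/ s); exists K => n; apply: INR_le.
rewrite mult_INR /lgexp lgexp_arg // -/s.
have [ge_ns _] := Rceil_bounds (INR n * s).
have ge_lg := Z_to_nat_ge (Rceil (INR n * s)).
have n_ge0 := pos_INR n.
have En : INR n = / s * (INR n * s) by field; lra.
rewrite [X in X <= _]En.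
have s' : 0 < / s by apply: Rinv_0_lt_compat.
have ns_ge0 : 0 <= INR n * s by apply: Rmult_le_pos; lra.
by apply: Rmult_le_compat; lra.
Qed.

Lemma lgexp_le d : exists r, 1 < r /\
  forall j n, (0 < j)%coq_nat -> (n <= d * S j)%coq_nat -> (lgexp eps r n <= j)%coq_nat.
Proof.
have d_ge0 := pos_INR d.
(* With [r = exp t] the slope is [1 / (2 (d + 1))]. For [j >= 1] one has [j + 1 <= 2 j], so
   [d (j + 1)] times the slope is at most [j], and so is its ceiling. *)
pose t := - ln eps / (2 * (INR d + 1)).
have t_gt0 : 0 < t by apply: Rdiv_lt_0_compat; lra.
have lt1r : 1 < exp t by rewrite -exp_0; apply: exp_increasing.
exists (exp t); split=> // j n /lt_INR /= j_gt0 /le_INR; rewrite mult_INR S_INR => le_n.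
have {}j_gt0 : 1 <= INR j.
  have := j_gt0; rewrite -[0]/(INR 0) => /INR_lt j0.
  by apply: (le_INR 1).
rewrite /lgexp lgexp_arg // ln_exp.
have -> : t / - ln eps = / (2 * (INR d + 1)) by rewrite /t; field; split; lra.
have le_j : INR n * / (2 * (INR d + 1)) <= INR j.
  apply: (Rmult_le_reg_r (2 * (INR d + 1))); first lra.
  rewrite Rmult_assoc Rinv_l; last lra.
  by have n_ge0 := pos_INR n; nra.
have [_ lt_c] := Rceil_bounds (INR n * / (2 * (INR d + 1))).
have : IZR (Rceil (INR n * / (2 * (INR d + 1)))) < IZR (Z.of_nat j + 1).
  by rewrite plus_IZR -INR_IZR_INZ; lra.
move=> /lt_IZR; set z := Rceil _ => lt_z.
by apply/Nat2Z.inj_le; case: (Z.lt_ge_cases z 0) => z0; lia.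
Qed.

End GrowthExponents.

(** * The linear growth bornology *)

Section LinearGrowth.

Variables (V : idomainType) (pi : V) (A : comAlgType V) (l : seq A).

Local Notation F := (deg_le l).

(** [growth d 1] is the module [N d]. The offset [e] adds up under products, so a product of [n]
    elements of [growth d 1] lies in [growth d n] with the same slope [d]. *)
Definition growth (d e : nat) : pset A :=
  span (fun x => exists i, pimul pi i (F (d * (i + e))) x).

Lemma submod_growth d e : submodule (growth d e).
Proof. exact: submod_span. Qed.

Lemma growth_gen d e i n w : (n <= d * (i + e))%N -> F n w -> growth d e (pi ^+ i *: w).
Proof.
by move=> le_n Fw; apply: mem_span; exists i, w; split=> //; apply: deg_leW Fw.
Qed.

Lemma growth_deg d e n w : (n <= d * e)%N -> F n w -> growth d e w.
Proof. by move=> le_n Fw; rewrite -[w]scale1r -(expr0 pi); apply: growth_gen Fw. Qed.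

Lemma growth_min d e (M : pset A) x : submodule M ->
  (forall i w, F (d * (i + e)) w -> M (pi ^+ i *: w)) -> growth d e x -> M x.
Proof. by move=> Msub MF; apply: span_min => // _ [i [w [Fw ->]]]; apply: MF. Qed.

Lemma growthW d d' e e' x :
  (forall i, (d * (i + e) <= d' * (i + e'))%N) -> growth d e x -> growth d' e' x.
Proof.
move=> le_d; apply: growth_min (submod_growth _ _) _ => i w; exact: growth_gen.
Qed.

Lemma growth_le d d' e x : (d <= d')%N -> growth d e x -> growth d' e x.
Proof. by move=> le_d; apply: growthW => i; rewrite leq_mul2r le_d orbT. Qed.

Lemma growthM d e e' x y :
  growth d e x -> growth d e' y -> growth d (e + e') (x * y).
Proof.
apply: span_mul (submod_growth _ _) _ => _ _ [i [v [Fv ->]]] [j [w [Fw ->]]].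
rewrite -scalerAl -scalerAr scalerA -exprD.
by apply: growth_gen (deg_leM Fv Fw); lia.
Qed.

Lemma growth_mul1 d x y : growth d 1 x -> growth d 1 y -> growth (d * 2) 1 (x * y).
Proof. by move=> dx dy; apply: growthW (growthM dx dy) => i; nia. Qed.

Lemma growth_modpow (M : pset A) d n x :
  (forall y, M y -> growth d 1 y) -> modpow M n x -> growth d n x.
Proof.
move=> Md; apply: span_min (submod_growth _ _) _ => _ [s [<- [sM ->]]].
elim: s sM => [|y s IHs] sM.
  by rewrite big_nil; apply: growth_deg (deg_le1 l 0).
rewrite big_cons /= -add1n; apply: growthM; first by apply/Md/sM; rewrite mem_head.
by apply: IHs => z sz; apply: sM; rewrite inE sz orbT.
Qed.

(* Terms of order at least [2n] can give up a factor [pi ^+ n] at the cost of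
   doubling [d]. *)
Lemma growth_split d n x : growth d 1 x -> exists y z,
  F (d * (n * 2)) y /\ pdiv pi (n * 2) (x - y) /\ growth (d * 2) 1 z /\
  x = y + pi ^+ n *: z.
Proof.
have [F0 [FD FZ]] := submod_deg_le l (d * (n * 2)).
have [g0 [gD gZ]] := submod_growth (d * 2) 1.
apply: (growth_min (M := fun x => exists y z,
  F (d * (n * 2)) y /\ pdiv pi (n * 2) (x - y) /\ growth (d * 2) 1 z /\
  x = y + pi ^+ n *: z)) => [|i w Fw].
  split; first by exists 0, 0; rewrite subr0 scaler0 addr0; do !split=> //; apply: pdiv0.
  split=> [x1 x2 [y1 [z1 [Fy1 [d1 [gz1 e1]]]]] [y2 [z2 [Fy2 [d2 [gz2 e2]]]]]
          | a x1 [y1 [z1 [Fy1 [d1 [gz1 e1]]]]]].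
    exists (y1 + y2), (z1 + z2); split; first exact: FD.
    split; first by rewrite opprD addrACA; apply: pdivD.
    by split; [apply: gD | rewrite e1 e2 scalerDr addrACA].
  exists (a *: y1), (a *: z1); split; first exact: FZ.
  split; first by rewrite -scalerBr; apply: pdivZ.
  by split; [apply: gZ | rewrite e1 scalerDr !scalerA mulrC].
have [lt_in | le_ni] := ltnP i (n * 2).
  exists (pi ^+ i *: w), 0; rewrite subrr scaler0 addr0.
  split; first by apply/FZ/(deg_leW _ Fw); nia.
  by split; first exact: pdiv0.
exists 0, (pi ^+ (i - n) *: w); rewrite subr0 add0r scalerA -exprD.
have -> : (n + (i - n) = i)%N by lia.
split=> //; split; first exact: pdiv_le le_ni (pdiv_scale _ _ _).
by split=> //; apply: growth_gen Fw; nia.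
Qed.

(** * Series with coefficients of linearly growing degree *)

Definition rep (d : nat) (z : nat -> A) : Prop :=
  exists w : nat -> A, (forall i, F (d * i.+1) (w i)) /\
    forall k, pdiv pi k (z k - \sum_(i < k) pi ^+ i *: w i).

Lemma repW d d' z : (d <= d')%N -> rep d z -> rep d' z.
Proof.
move=> le_d [w [Fw zw]]; exists w; split=> // i.
by apply: deg_leW (Fw i); rewrite leq_mul2r le_d orbT.
Qed.

Lemma rep_eq d z z' : hat_eq pi z z' -> rep d z -> rep d z'.
Proof.
move=> zz' [w [Fw zw]]; exists w; split=> // k.
by apply: pdiv_trans (zw k); apply: pdivC.
Qed.

Lemma rep0 d : rep d (fun=> 0).
Proof.
exists (fun=> 0); split=> [i | k]; first by case: (submod_deg_le l (d * i.+1)).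
by rewrite big1 ?subrr => [|i _]; [apply: pdiv0 | apply: scaler0].
Qed.

Lemma repD d z z' : rep d z -> rep d z' -> rep d (fun k => z k + z' k).
Proof.
move=> [w [Fw zw]] [w' [Fw' zw']]; exists (fun i => w i + w' i); split=> [i | k].
  by case: (submod_deg_le l (d * i.+1)) => _ [FD _]; apply: FD.
under eq_bigr do rewrite scalerDr.
by rewrite big_split opprD addrACA; apply: pdivD.
Qed.

Lemma repZ d a z : rep d z -> rep d (fun k => a *: z k).
Proof.
move=> [w [Fw zw]]; exists (fun i => a *: w i); split=> [i | k].
  by case: (submod_deg_le l (d * i.+1)) => _ [_]; apply.
under eq_bigr do rewrite scalerA mulrC -scalerA.
by rewrite -scaler_sumr -scalerBr; apply: pdivZ.
Qed.

Lemma rep_growth d x : growth d 1 x -> rep d (hat_of x).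
Proof.
apply: (growth_min (M := fun x => rep d (hat_of x))) => [|i w Fw].
  by split; [apply: rep0 | split=> *; [apply: repD | apply: repZ]].
exists (fun k => if k == i then w else 0); split=> [k|k].
  case: eqP => [-> | _]; first by rewrite -addn1.
  by case: (submod_deg_le l (d * k.+1)).
have [le_ki | lt_ik] := leqP k i.
  rewrite big1 ?subr0 => [|[j lt_j] _ /=]; first exact: pdiv_le (pdiv_scale _ _ _).
  by rewrite ltn_eqF ?scaler0 //; apply: leq_trans le_ki.
rewrite (bigD1 (Ordinal lt_ik)) //= eqxx big1 ?addr0 => [|j].
  by rewrite /hat_of subrr; apply: pdiv0.
by rewrite -val_eqE /= => /negPf->; rewrite scaler0.
Qed.

(* Passing to every other partial sum makes the series converge at rate [pi ^+ k]
   inside a single [growth]. *)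
Lemma rep_seq d z : rep d z -> exists x : nat -> A, forall k,
  growth d 1 (x k) /\ pdiv pi k (z k - x k) /\
  pimul pi k (growth (d * 2) 1) (x k.+1 - x k).
Proof.
move=> [w [Fw zw]]; exists (fun k => \sum_(i < k * 2) pi ^+ i *: w i) => k.
split.
  apply: submod_sum (submod_growth _ _) _ => i _.
  by apply: growth_gen (Fw i); rewrite addn1.
split.
  have := zw k; have : pdiv pi k (\sum_(i < k * 2) pi ^+ i *: w i -
      \sum_(i < k) pi ^+ i *: w i).
    rewrite muln2 -addnn big_split_ord /= [X in X - _]addrC addrK.
    apply: submod_sum (submod_pdiv _ _ _) _ => i _.
    by apply: pdiv_le (pdiv_scale _ _ _); apply: leq_addr.
  by move=> /pdivC dx dz; apply: pdiv_trans dz dx.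
rewrite mulSn add2n !big_ord_recr /= -[X in X - _]addrA [X in X - _]addrC addrK.
(* Only the terms of order [2k] and [2k + 1] remain; after [pi ^+ k] is extracted their orders are
   [k] and [k + 1], hence the doubled slope. *)
exists (pi ^+ k *: w (k * 2)%N + pi ^+ k.+1 *: w (k * 2).+1); split.
  case: (submod_growth (d * 2) 1) => _ [gD _].
  by apply: gD; apply: growth_gen (Fw _); nia.
by rewrite scalerDr !scalerA -!exprD; congr (_ ^+ _ *: _ + _ ^+ _ *: _); lia.
Qed.

Lemma rep_MW (M : pset A) d c z : (forall y, M y -> F d y) -> Rlt R0 c ->
  has_MW_rep pi M c z -> rep (d * Z.to_nat (up c)) z.
Proof.
move=> Md c_gt0 [w [kap [Mw [le_c zw]]]]; exists w; split=> // i.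
apply: deg_leW (modpow_deg_le Md (Mw i)); rewrite -mulnA leq_mul2l.
apply/orP; right; apply/leP/INR_le; rewrite mult_INR.
apply: Rle_trans (le_c i) _; apply: Rmult_le_compat_r; first exact: pos_INR.
have [ltc _] := archimed c.
by apply: Rle_trans (Z_to_nat_ge _); apply: Rlt_le.
Qed.

(** Elements of degree at most [n] lie in the [n]-th power of the span of [1] and the generators.
    The constant is [d.+1] so that it is positive even for [d = 0]. *)
Lemma MW_rep d z : rep d z ->
  has_MW_rep pi (span (fun y => y \in 1 :: l)) (INR d.+1) z.
Proof.
move=> [w [Fw zw]]; exists w, (fun i => d.+1 * i.+1)%N; split=> [i|].
  by apply: deg_le_modpow; apply: deg_leW (Fw i); rewrite leq_mul2r leqnSn orbT.
by split=> // i; rewrite mult_INR; apply: Rle_refl.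
Qed.

Lemma MW_gen_gens : MW_gen (span (fun y => y \in 1 :: l)).
Proof. by split; [apply: mem_span; rewrite mem_head | exists (1 :: l)]. Qed.

Hypothesis gen : generates l.

Lemma fine_growth (S : pset A) : fine S -> exists d, forall x, S x -> growth d 1 x.
Proof.
move=> [s Ss]; have [d sd] := deg_le_ex_seq s gen; exists d => x /Ss.
by apply: span_min (submod_growth _ _) _ => y /sd; apply: growth_deg; rewrite muln1.
Qed.

Lemma deg_le_fine n : fine (F n).
Proof.
pose ms := [seq (m : 'X_{1..size l}) | m : 'X_{1..(size l) < n.+1}].
exists [seq monomial m | m <- ms] => x.
apply: span_sub => _ [m le_mn ->]; apply: map_f; apply/mapP.
by exists (BMultinom (bound := n.+1) (bmnm := m) le_mn); rewrite ?mem_enum.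
Qed.

Lemma MW_boundedP S : MW_bounded pi S <-> exists d, forall z, S z -> rep d z.
Proof.
split=> [[M [c [[M1 [s Ms]] [c_gt0 Srep]]]] | [d Srep]].
  have [d sd] := deg_le_ex_seq s gen; exists (d * Z.to_nat (up c))%N => z /Srep.
  apply: rep_MW => // y /Ms; exact: span_min (submod_deg_le _ _) sd.
exists (span (fun y => y \in 1 :: l)), (INR d.+1); split; first exact: MW_gen_gens.
by split=> [|z /Srep/MW_rep //]; apply: lt_0_INR; lia.
Qed.

Lemma in_MWP z : in_MW pi z <-> exists d, rep d z.
Proof.
split=> [[M [c [genM [c_gt0 zrep]]]] | [d zrep]].
  have [] := (MW_boundedP (eq z)).1; last by move=> d; exists d; auto.
  by exists M, c; split=> //; split=> // _ <-.
by exists (span (fun y => y \in 1 :: l)), (INR d.+1); split;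
  [apply: MW_gen_gens | split; [apply: lt_0_INR; lia | apply: MW_rep]].
Qed.

Definition growth_born : pset (pset A) :=
  fun S => exists d, forall x, S x -> growth d 1 x.

Lemma growth_born_alg : is_alg_bornology growth_born.
Proof.
split; first split.
- by move=> s; apply: fine_growth; exists s => x; apply: mem_span.
- split=> [S T [d Td] ST |]; first by exists d => x /ST/Td.
  split=> [S T [d Sd] [d' Td'] | S [d Sd]]; last first.
    by exists d => x; apply: span_min (submod_growth _ _) Sd.
  exists (maxn d d') => x [/Sd | /Td']; apply: growth_le; lia.
move=> S T [d Sd] [d' Td']; exists (maxn d d' * 2)%N => _ [x [y [Sx [Ty ->]]]].
apply: growth_mul1; [apply: growth_le (Sd x Sx) | apply: growth_le (Td' y Ty)]; lia.
Qed.

Variable eps : R.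
Hypotheses (eps_gt0 : Rlt R0 eps) (eps_lt1 : Rlt eps R1).

(** The [n]-th power of [M] lies in [growth d n], and [n <= K * e] for the exponent [e] of [pi]; the
    factor [pi ^+ e] thus pays for the offset [n] once the slope is [d * K.+1]. *)
Lemma growth_born_rho (M : pset A) : growth_born M -> rho_le1 pi eps growth_born M.
Proof.
move=> [d Md] r lt1r; have [K leK] := lgexp_ge eps_gt0 eps_lt1 lt1r.
exists (d * K.+1)%N => x.
apply: submod_sums (submod_growth _ _) _ => _ [n [y [My ->]]].
have := growth_modpow Md My; set e := lgexp _ _ _.
have le_n : (n <= K * e)%N by apply/leP/leK.
apply: (growth_min (M := fun y => growth (d * K.+1) 1 (pi ^+ e *: y))) => [|i w Fw].
  apply: submod_preim (submod_growth _ _).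
  split=> [u v | a u]; first by rewrite scalerDr.
  by rewrite !scalerA mulrC.
rewrite scalerA -exprD; apply: growth_gen Fw.
rewrite -mulnA leq_mul2l; apply/orP; right; nia.
Qed.

(** [growth_born] is itself one of the bornologies being intersected. Conversely, the growth
    condition for the span of [1] and the generators, with [r] close enough to 1, already bounds
    every [growth d 1]. *)
Lemma lg_bornP S : lg_born pi eps (@fine V A) S <-> growth_born S.
Proof.
split=> [|[d Sd] B Balg fineB rhoB].
  apply; first exact: growth_born_alg.
    exact: fine_growth.
  by move=> M gM _; apply: growth_born_rho.
have [[Bfin [Bsub [BU Bspan]]] BM] := Balg.
pose M := span (fun y => y \in 1 :: l).
have BMgens : B M by apply/Bspan/Bfin.
have [r [lt1r le_r]] := lgexp_le eps_gt0 eps_lt1 d.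
have := rhoB M BMgens (submod_span _) r lt1r; set T := sums _ => BT.
have BFT := Bspan _ (BU _ _ (fineB _ (deg_le_fine (d * 1))) BT).
apply: Bsub BFT _ => x /Sd.
apply: growth_min (submod_span _) _ => i w Fw; apply: mem_span.
(* The term of order 0 has no power of [pi] to spend and is covered by the fine bornology;
   [lgexp_le] handles positive orders. *)
case: i Fw => [|i] Fw; [left | right]; first by rewrite expr0 scale1r.
have le_e : (lgexp eps r (d * (i.+1 + 1)) <= i.+1)%N.
  by apply/leP/le_r; [lia | apply/leP; rewrite addn1].
exists [:: pi ^+ i.+1 *: w]; rewrite big_seq1; split=> // y; rewrite inE => /eqP->.
exists (d * (i.+1 + 1))%N, (pi ^+ (i.+1 - lgexp eps r (d * (i.+1 + 1))) *: w).
split; last by rewrite scalerA -exprD subnKC.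
exact: submodZ (submod_span _) (deg_le_modpow Fw).
Qed.

End LinearGrowth.

(** * Division by powers of [pi] inside the growth modules *)

Section BoundedDivision.

Variables (V : idomainType) (pi : V) (A : comAlgType V) (l : seq A).
Hypothesis pi_dvr : forall c : V, c \is a GRing.unit \/ exists c', c = pi * c'.
Hypothesis gen : generates l.

Lemma divide_pow : exists D, forall n K x, deg_le l n x -> pdiv pi K x ->
  exists q, deg_le l (n + K * D) q /\ x = pi ^+ K *: q.
Proof.
have [D divD] := divide_once pi_dvr gen; exists D => n K x nx.
elim: K => [_ | K IHK dx]; first by exists x; rewrite addn0 scale1r.
have [q [Fq ex]] := IHK (pdiv_le (leqnSn K) dx).
have [|q' [Fq' ex']] := divD _ K _ Fq; first by rewrite -ex.
by exists q'; rewrite ex ex' mulSn addnA addnAC.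
Qed.

(** Split [x] at order [2K]. The head has degree at most [2dK] and is divisible by [pi ^+ (K * 2)],
    with quotient [q] of degree at most [2K(d + D)]. Half of the divisibility is given up: the
    remaining [pi ^+ K] in [pi ^+ K *: q] pays for this degree. *)
Lemma growth_divide d : exists d', forall K x, growth pi l d 1 x ->
  pdiv pi (K * 2) x -> pimul pi K (growth pi l d' 1) x.
Proof.
have [D divD] := divide_pow; exists ((d + D) * 2)%N => K x.
case/(growth_split K) => y [z [Fy [dxy [gz ex]]]]; rewrite {}ex in dxy * => dx.
have {dx dxy} : pdiv pi (K * 2) y.
  rewrite -[y](subKr (y + pi ^+ K *: z)).
  exact: pdivB dx dxy.
case/(divD _ _ _ Fy) => q [Fq ->]; exists (pi ^+ K *: q + z); split; last first.
  by rewrite scalerDr scalerA -exprD addnn muln2.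
case: (submod_growth pi l ((d + D) * 2) 1) => _ [gD _]; apply: gD.
  by apply: growth_gen Fq; nia.
by apply: growth_le gz; nia.
Qed.

End BoundedDivision.

(** * The Monsky-Washnitzer completion *)

Section HatRepresentatives.

Variables (V : idomainType) (pi : V) (A : lmodType V).

Definition hat_repr (z : nat -> A) : nat -> A :=
  epsilon (inhabits (fun=> 0)) (hat_eq pi z).

Lemma hat_reprK z : hat_eq pi (hat_repr z) z.
Proof.
apply: hat_eq_sym; rewrite /hat_repr; apply: epsilon_spec.
by exists z; apply: hat_eqxx.
Qed.

(** Congruent sequences define extensionally equal predicates, from which [epsilon] picks the same
    witness. *)
Lemma hat_repr_eq z z' : hat_eq pi z z' -> hat_repr z = hat_repr z'.
Proof.
move=> zz'; rewrite /hat_repr; congr epsilon; apply/boolp.funext => u.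
apply/boolp.propext; split; apply: hat_eq_trans => //.
exact: hat_eq_sym.
Qed.

End HatRepresentatives.

(* The module [A^dagger]: each class modulo [hat_eq] is stored as its [hat_repr]. *)
Record dagger (V : idomainType) (pi : V) (A : comAlgType V) (l : seq A) := Dagger {
  dval : nat -> A;
  dval_rep : exists d, rep pi l d dval;
  dval_repr : hat_repr pi dval = dval }.

Section DaggerModule.

Variables (V : idomainType) (pi : V) (A : comAlgType V) (l : seq A).

Local Notation dagger := (@dagger V pi A l).
Local Notation rep := (rep pi l).

Lemma dval_inj (x y : dagger) : hat_eq pi (dval x) (dval y) -> x = y.
Proof.
case: x y => [x xrep xE] [y yrep yE] /= /hat_repr_eq; rewrite xE yE => exy.
rewrite exy in xrep xE *; congr Dagger; exact: boolp.Prop_irrelevance.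
Qed.

Fact dag_rep z : (exists d, rep d z) -> exists d, rep d (hat_repr pi z).
Proof.
by case=> d zd; exists d; apply: rep_eq zd; apply/hat_eq_sym/hat_reprK.
Qed.

Fact dag_repr z : hat_repr pi (hat_repr pi z) = hat_repr pi z :> (nat -> A).
Proof. exact/hat_repr_eq/hat_reprK. Qed.

Definition dag z (zrep : exists d, rep d z) : dagger :=
  Dagger (dag_rep zrep) (dag_repr z).

Lemma dagK z (zrep : exists d, rep d z) : hat_eq pi (dval (dag zrep)) z.
Proof. exact: hat_reprK. Qed.

Fact dag0_rep : exists d, rep d (fun=> 0).
Proof. by exists 0%N; apply: rep0. Qed.

Fact dagD_rep (x y : dagger) : exists d, rep d (fun k => dval x k + dval y k).
Proof.
have [[d xd] [d' yd']] := (dval_rep x, dval_rep y); exists (maxn d d').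
by apply: repD; [apply: repW xd | apply: repW yd']; lia.
Qed.

Fact dagZ_rep a (x : dagger) : exists d, rep d (fun k => a *: dval x k).
Proof. by have [d xd] := dval_rep x; exists d; apply: repZ. Qed.

Definition dag0 := dag dag0_rep.
Definition dag_add x y := dag (dagD_rep x y).
Definition dag_scale a x := dag (dagZ_rep a x).
Definition dag_opp := dag_scale (- 1).

Lemma dval_dag0 k : pdiv pi k (dval dag0 k - 0).
Proof. exact: (dagK dag0_rep). Qed.

Lemma dval_dagD x y k : pdiv pi k (dval (dag_add x y) k - (dval x k + dval y k)).
Proof. exact: (dagK (dagD_rep x y)). Qed.

Lemma dval_dagZ a x k : pdiv pi k (dval (dag_scale a x) k - a *: dval x k).
Proof. exact: (dagK (dagZ_rep a x)). Qed.

Lemma pdiv_addr k (x x' y y' : A) :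
  pdiv pi k (x - x') -> pdiv pi k (y - y') -> pdiv pi k (x + y - (x' + y')).
Proof. by move=> dx dy; rewrite opprD addrACA; apply: pdivD. Qed.

Lemma pdiv_scaler k a (x x' : A) :
  pdiv pi k (x - x') -> pdiv pi k (a *: x - a *: x').
Proof. by rewrite -scalerBr; apply: pdivZ. Qed.

Lemma pdiv_refl k (x : A) : pdiv pi k (x - x).
Proof. by rewrite subrr; apply: pdiv0. Qed.

Hint Resolve pdiv_refl : core.

Fact dag_addA : associative dag_add.
Proof.
move=> x y z; apply: dval_inj => k.
apply: pdiv_trans (dval_dagD _ _ _) _.
apply: pdiv_trans (pdiv_addr (pdiv_refl _ _) (dval_dagD _ _ _)) _.
rewrite [X in X - _]addrA; apply: pdivC; apply: pdiv_trans (dval_dagD _ _ _) _.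
exact: pdiv_addr (dval_dagD _ _ _) _.
Qed.

Fact dag_addC : commutative dag_add.
Proof.
move=> x y; apply: dval_inj => k; apply: pdiv_trans (dval_dagD _ _ _) _.
by rewrite [X in X - _]addrC; apply/pdivC/dval_dagD.
Qed.

Fact dag_add0 : left_id dag0 dag_add.
Proof.
move=> x; apply: dval_inj => k; apply: pdiv_trans (dval_dagD _ _ _) _.
by rewrite -[X in _ - X]add0r; apply: pdiv_addr (dval_dag0 _) _.
Qed.

Fact dag_addN : left_inverse dag0 dag_opp dag_add.
Proof.
move=> x; apply: dval_inj => k; apply: pdiv_trans (dval_dagD _ _ _) _.
apply: pdiv_trans (pdiv_addr (dval_dagZ _ _ _) (pdiv_refl _ _)) _.
by rewrite scaleN1r addNr; apply/pdivC/dval_dag0.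
Qed.

HB.instance Definition _ := boolp.gen_eqMixin dagger.
HB.instance Definition _ := boolp.gen_choiceMixin dagger.
HB.instance Definition _ :=
  GRing.isZmodule.Build dagger dag_addA dag_addC dag_add0 dag_addN.

Fact dag_scaleA a b x : dag_scale a (dag_scale b x) = dag_scale (a * b) x.
Proof.
apply: dval_inj => k; apply: pdiv_trans (dval_dagZ _ _ _) _.
apply: pdiv_trans (pdiv_scaler _ (dval_dagZ _ _ _)) _.
by rewrite scalerA; apply/pdivC/dval_dagZ.
Qed.

Fact dag_scale1 : left_id 1 dag_scale.
Proof.
by move=> x; apply: dval_inj => k; rewrite -[X in _ - X]scale1r; apply: dval_dagZ.
Qed.

Fact dag_scaleDr : right_distributive dag_scale +%R.
Proof.
move=> a x y; apply: dval_inj => k; apply: pdiv_trans (dval_dagZ _ _ _) _.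
apply: pdiv_trans (pdiv_scaler _ (dval_dagD _ _ _)) _.
rewrite scalerDr; apply: pdivC; apply: pdiv_trans (dval_dagD _ _ _) _.
by apply: pdiv_addr; apply: dval_dagZ.
Qed.

Fact dag_scaleDl x : {morph dag_scale^~ x : a b / a + b}.
Proof.
move=> a b; apply: dval_inj => k; apply: pdiv_trans (dval_dagZ _ _ _) _.
rewrite scalerDl; apply: pdivC; apply: pdiv_trans (dval_dagD _ _ _) _.
by apply: pdiv_addr; apply: dval_dagZ.
Qed.

HB.instance Definition _ := GRing.Zmodule_isLmodule.Build V dagger
  dag_scaleA dag_scale1 dag_scaleDr dag_scaleDl.

Lemma dvalD (x y : dagger) k : pdiv pi k (dval (x + y) k - (dval x k + dval y k)).
Proof. exact: dval_dagD. Qed.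

Lemma dvalZ a (x : dagger) k : pdiv pi k (dval (a *: x) k - a *: dval x k).
Proof. exact: dval_dagZ. Qed.

Lemma dval0 k : pdiv pi k (dval (0 : dagger) k).
Proof. by rewrite -[dval _ _]subr0; apply: dval_dag0. Qed.

Definition dag_ball (d : nat) : pset dagger := fun x => rep d (dval x).

Lemma submod_dag_ball d : submodule (dag_ball d).
Proof.
split; first by apply: rep_eq (rep0 pi l d) => k; rewrite sub0r -scaleN1r; apply/pdivZ/dval0.
split=> [x y xd yd | a x xd].
  by apply: rep_eq (repD xd yd) => k; apply/pdivC/dvalD.
by apply: rep_eq (repZ a xd) => k; apply/pdivC/dvalZ.
Qed.

Definition dag_born : pset (pset dagger) :=
  fun S => exists d, forall x, S x -> dag_ball d x.

Lemma dag_ballW d d' x : (d <= d')%N -> dag_ball d x -> dag_ball d' x.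
Proof. exact: repW. Qed.

Lemma dag_born_bornology : is_bornology dag_born.
Proof.
split; first last.
  split=> [S T [d Td] ST | ]; first by exists d => x /ST/Td.
  split=> [S T [d Sd] [d' Td'] | S [d Sd]]; last first.
    by exists d => x; apply: span_min (submod_dag_ball _) Sd.
  exists (maxn d d') => x [/Sd | /Td']; apply: dag_ballW; lia.
elim=> [|x s [d sd]]; first by exists 0%N.
have [d' xd'] := dval_rep x; exists (maxn d d') => y.
rewrite inE => /orP[/eqP-> | /sd]; last by apply: dag_ballW; lia.
by apply: dag_ballW xd'; lia.
Qed.

(** Divisibility by [pi ^+ k] kills the class modulo [pi ^+ k], so this is inherited from the
    [pi]-adic completion. *)
Lemma dag_separated (M : pset dagger) : padic_separated pi M.
Proof.
move=> x xM; apply: dval_inj => k; apply: pdivB (dval0 k).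
have [y [_ ->]] := xM k; rewrite -[dval _ _](subrK (pi ^+ k *: dval y k)).
by apply: pdivD; [apply: dvalZ | apply: pdiv_scale].
Qed.

(* [tail_coef w j] are the coefficients of the Cauchy product
   [\sum_i pi ^+ i * (\sum_n pi ^+ n * w (i + j) n)]. *)
Fixpoint tail_coef (w : nat -> nat -> A) (j n : nat) : A :=
  w j n + if n is n'.+1 then tail_coef w j.+1 n' else 0.

(** Here [s j] is the sum of all [pi ^+ i *: m (i + j)]. Its coefficient of order [n] adds
    coefficients of orders at most [n], so the bound [d] is not worsened. *)
Lemma dag_tails d (m : nat -> dagger) : (forall j, dag_ball d (m j)) ->
  exists s : nat -> dagger, forall j, dag_ball d (s j) /\ s j = m j + pi *: s j.+1.
Proof.
move=> md; have /boolp.choice[w wP] : forall j, exists w : nat -> A,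
    (forall i, deg_le l (d * i.+1) (w i)) /\
    forall k, pdiv pi k (dval (m j) k - \sum_(i < k) pi ^+ i *: w i).
  exact: md.
pose W := tail_coef w; pose z j k := \sum_(i < k) pi ^+ i *: W j i.
have Wd j n : deg_le l (d * n.+1) (W j n).
  elim: n j => [|n IHn] j.
    by rewrite /W /= addr0; case: (wP j).
  apply: submodD (submod_deg_le _ _) _ _; first by case: (wP j).
  by apply: deg_leW (IHn j.+1); rewrite leq_mul2l leqnSn orbT.
have zd j : rep d (z j) by exists (W j); split=> // k; apply: pdiv_refl.
pose s j := dag (ex_intro _ d (zd j)); exists s => j.
split; first by apply: rep_eq (zd j); apply/hat_eq_sym/dagK.
apply: dval_inj => k; apply: pdiv_trans (dagK _ k) _.
apply: pdivC; apply: pdiv_trans (dvalD _ _ _) _.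
have [_ /(_ k) mk] := wP j.
apply: pdiv_trans (pdiv_addr mk (dvalZ _ _ _)) _.
apply: pdiv_trans (pdiv_addr (pdiv_refl _ _) (pdiv_scaler _ (dagK _ k))) _.
rewrite /z; case: k {mk} => [|k].
  by rewrite !big_ord0 scaler0 addr0.
have -> : \sum_(i < k.+1) pi ^+ i *: W j i =
    \sum_(i < k.+1) pi ^+ i *: w j i + pi *: \sum_(i < k) pi ^+ i *: W j.+1 i.
  rewrite big_ord_recl [in RHS]big_ord_recl /= /W /= addr0 -addrA; congr (_ + _).
  rewrite scaler_sumr -big_split; apply: eq_bigr => i _ /=.
  by rewrite scalerDr scalerA exprS.
(* The two sides differ by one last term, which has order [k.+1] after multiplication by [pi]. *)
rewrite [\sum_(i < k.+1) _ *: W j.+1 _]big_ord_recr /=.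
rewrite opprD addrACA subrr add0r -scalerBr addrAC subrr add0r scalerA -exprS.
exact: pdiv_scale.
Qed.

Lemma dag_ball_complete d : padic_complete pi (dag_ball d).
Proof.
move=> x xd dx.
have /boolp.choice[m mP] : forall j, exists m, dag_ball d m /\
    x j.+1 - x j = pi ^+ j *: m by exact: dx.
have [s sP] := dag_tails (fun j => (mP j).1).
(* The limit is the telescoping series of the differences [pi ^+ j *: m j]; its distance to [x j] is
   exactly [pi ^+ j *: s j]. *)
exists (x 0%N + s 0%N); split=> [|j].
  by apply: submodD (submod_dag_ball d) _ _ => //; apply: (sP 0%N).1.
exists (s j); split; first by case: (sP j).
elim: j => [|j IHj]; first by rewrite addrAC subrr add0r scale1r.
have [_ e1] := mP j; have [_ e2] := sP j.
rewrite -[x j.+1](subrK (x j)) e1 opprD addrCA IHj e2 scalerDr.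
by rewrite addKr scalerA -exprSr.
Qed.

Lemma dag_born_complete : complete_born pi dag_born.
Proof.
split=> [S [d Sd] | M _ _]; last exact: dag_separated.
exists (dag_ball d); split; first by exists d.
by split; [apply: submod_dag_ball | split; first apply: dag_ball_complete].
Qed.

Hypothesis gen : generates l.

Fact dag_of_rep (x : A) : exists d, rep d (hat_of x).
Proof.
have [d xd] := deg_le_ex x gen; exists d; apply: rep_growth.
by apply: growth_deg xd; rewrite muln1.
Qed.

Definition dag_of (x : A) : dagger := dag (dag_of_rep x).

Lemma dval_of x : hat_eq pi (dval (dag_of x)) (hat_of x).
Proof. exact: dagK. Qed.

Lemma dag_of_lin : lin dag_of.
Proof.
split=> [x y | a x]; apply: dval_inj => k; apply: pdiv_trans (dval_of _ k) _;
  apply: pdivC.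
  apply: pdiv_trans (dvalD _ _ _) _.
  exact: pdiv_addr (dval_of _ k) (dval_of _ k).
by apply: pdiv_trans (dvalZ _ _ _) _; apply: pdiv_scaler (dval_of _ k).
Qed.

Lemma dag_of_bounded : bounded_map (growth_born pi l) dag_born dag_of.
Proof.
move=> S [d Sd]; exists d => _ [x [/Sd/rep_growth xd ->]].
by apply: rep_eq xd; apply/hat_eq_sym/dval_of.
Qed.

End DaggerModule.

(** * The isomorphism *)

Lemma dvr_cases (V : idomainType) (pi : V) : is_cdvr pi ->
  forall c : V, c \is a GRing.unit \/ exists c', c = pi * c'.
Proof.
move=> [_ [_ [fact _]]] c; have [-> | /fact[u [[|n] [uu ->]]]] := eqVneq c 0.
- by right; exists 0; rewrite mulr0.
- by left; rewrite mulr1.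
by right; exists (u * pi ^+ n); rewrite mulrCA -exprS.
Qed.

(** * The graph of the comparison map *)

Section Approximation.

Variables (V : idomainType) (pi : V) (A : comAlgType V) (l : seq A).
Variables (C : algType V) (BC : pset (pset C)) (j : A -> C).
Hypotheses (pi_dvr : forall c : V, c \is a GRing.unit \/ exists c', c = pi * c')
  (gen : generates l) (BC_alg : is_alg_bornology BC)
  (BC_complete : complete_born pi BC) (j_hom : rhom j) (j_lin : lin j)
  (j_bounded : bounded_map (growth_born pi l) BC j).

(* The sequence [z] and the element [c] are limits of one linearly growing
   sequence in [A]: the graph of the comparison map. *)
Definition approx (z : nat -> A) (c : C) : Prop :=
  exists d (N : pset C) (x : nat -> A), BC N /\ submodule N /\
    forall k, growth pi l d 1 (x k) /\ pdiv pi k (z k - x k) /\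
      pimul pi k N (c - j (x k)).

Let BC_fin (s : seq C) : BC (fun x => x \in s).
Proof. by case: BC_alg => -[]. Qed.

Let BC_U S T : BC S -> BC T -> BC (span (fun x => S x \/ T x)).
Proof.
by case: BC_alg => -[_ [_ [BU Bspan]]] _ bS bT; apply/Bspan/BU.
Qed.

Let BC_M S T : BC S -> BC T -> BC (setmul S T).
Proof. by case: BC_alg => _; apply. Qed.

Let BC_growth d : BC (fun c => exists x, growth pi l d 1 x /\ c = j x).
Proof. by apply: j_bounded; exists d. Qed.

Let in_span_l (M N : pset C) x : M x -> span (fun y => M y \/ N y) x.
Proof. by move=> Mx; apply: mem_span; left. Qed.

Let in_span_r (M N : pset C) x : N x -> span (fun y => M y \/ N y) x.
Proof. by move=> Nx; apply: mem_span; right. Qed.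

Lemma approxD z z' c c' :
  approx z c -> approx z' c' -> approx (fun k => z k + z' k) (c + c').
Proof.
move=> [d [N [x [BN [Nsub xP]]]]] [d' [N' [x' [BN' [Nsub' xP']]]]].
exists (maxn d d'), (span (fun y => N y \/ N' y)), (fun k => x k + x' k).
split; first exact: BC_U.
split=> [|k]; first exact: submod_span.
have [[gx [dx Nx]] [gx' [dx' Nx']]] := (xP k, xP' k).
split.
  by apply: submodD (submod_growth _ _ _ _) _ _;
    [apply: growth_le gx | apply: growth_le gx']; lia.
split; first exact: pdiv_addr.
rewrite linD // opprD addrACA.
apply: submodD (submod_pimul _ _ (submod_span _)) _ _.
  by apply: pimul_sub Nx => y; apply: in_span_l.
by apply: pimul_sub Nx' => y; apply: in_span_r.
Qed.

Lemma approxZ a z c : approx z c -> approx (fun k => a *: z k) (a *: c).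
Proof.
move=> [d [N [x [BN [Nsub xP]]]]]; exists d, N, (fun k => a *: x k).
do 2!split=> //; move=> k; have [gx [dx Nx]] := xP k.
split; first exact: submodZ (submod_growth _ _ _ _) gx.
split; first exact: pdiv_scaler.
by rewrite linZ // -scalerBr; apply: submodZ (submod_pimul _ _ _) Nx.
Qed.

Lemma approxM z z' c c' :
  approx z c -> approx z' c' -> approx (fun k => z k * z' k) (c * c').
Proof.
move=> [d [N [x [BN [Nsub xP]]]]] [d' [N' [x' [BN' [Nsub' xP']]]]].
pose G := fun c => exists x, growth pi l d 1 x /\ c = j x.
(* The error is [(c - j x) c' + j x (c' - j x')]; these bounded sets contain the two summands, up to
   [pi ^+ k], for all [k] at once. *)
exists (maxn d d' * 2)%N,
  (span (fun y => setmul N (fun y => y \in [:: c']) y \/ setmul G N' y)),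
  (fun k => x k * x' k).
split; first by apply: BC_U; apply: BC_M => //; apply: BC_growth.
split=> [|k]; first exact: submod_span.
have [[gx [dx [y [Ny ey]]]] [gx' [dx' [y' [Ny' ey']]]]] := (xP k, xP' k).
split.
  by apply: growth_mul1; [apply: growth_le gx | apply: growth_le gx']; lia.
split.
  rewrite -(subrKA (x k * z' k)) -mulrBl -mulrBr.
  have [[u ->] [v ->]] := (dx, dx'); rewrite -scalerAl -scalerAr.
  by apply: pdivD; apply: pdiv_scale.
have [_ jM] := j_hom.
rewrite jM -(subrKA (j (x k) * c')) -mulrBl -mulrBr ey ey' -scalerAl -scalerAr.
apply: submodD (submod_pimul _ _ (submod_span _)) _ _.
  by exists (y * c'); split=> //; apply: in_span_l; exists y, c'; rewrite inE eqxx.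
exists (j (x k) * y'); split=> //; apply: in_span_r; exists (j (x k)), y'.
by split=> //; exists (x k).
Qed.

(** If [z] vanishes, the term at index [2k] is divisible by [pi ^+ (k * 2)] in [A], hence by
    [pi ^+ k] inside one growth module. So [c] lies in [pi ^+ k] times a fixed bounded submodule for
    every [k], and separatedness applies. *)
Lemma approx_eq0 z c : approx z c -> hat_eq pi z (fun=> 0) -> c = 0.
Proof.
move=> [d [N [x [BN [Nsub xP]]]]] z0; have [d' divd] := growth_divide pi_dvr gen d.
pose G := fun c => exists x, growth pi l d' 1 x /\ c = j x.
have [_ sep] := BC_complete.
apply: (sep (span (fun y => N y \/ G y))) => [||k]; first exact: BC_U (BC_growth d').
  exact: submod_span.
have [gx [dx Nx]] := xP (k * 2)%N.
rewrite -(subrK (j (x (k * 2)%N)) c).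
apply: submodD (submod_pimul _ _ (submod_span _)) _ _.
  apply: (pimul_sub (M := N)) => [y|]; first exact: in_span_l.
  by apply: (pimul_le Nsub _ Nx); rewrite leq_pmulr.
have [|y [gy ->]] := divd k _ gx.
  by rewrite -[x _]subr0; apply: pdiv_trans (z0 _); apply: pdivC.
by exists (j y); rewrite linZ //; split=> //; apply: in_span_r; exists y.
Qed.

Lemma approx_inj z z' c c' : hat_eq pi z z' -> approx z c -> approx z' c' -> c = c'.
Proof.
move=> zz' zc zc'; apply/eqP; rewrite -subr_eq0; apply/eqP.
have := approxD zc (approxZ (- 1) zc'); rewrite scaleN1r => /approx_eq0; apply=> k.
by rewrite subr0 scaleN1r; apply: zz'.
Qed.

(** The images of the partial sums form a Cauchy sequence in a complete bounded [M] containing the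
    image of [growth d' 1] for [d' = 2d]. That [M] serves all [z] makes the inverse map bounded. *)
Lemma approx_ex d : exists2 M, BC M & forall z, rep pi l d z ->
  exists2 c, M c & approx z c.
Proof.
have [complC _] := BC_complete.
have [M [BM [Msub [Mcompl jM]]]] := complC _ (BC_growth (d * 2)).
exists M => // z /rep_seq[x xP].
have jMg d' y : (d' <= d * 2)%N -> growth pi l d' 1 y -> M (j y).
  by move=> le_d gy; apply: jM; exists y; split=> //; apply: growth_le gy.
have [|k|c [Mc cP]] := Mcompl (fun k => j (x k)).
- by move=> k; have [gx _] := xP k; apply: jMg gx; rewrite leq_pmulr.
- have [_ [_ [y [gy ey]]]] := xP k; exists (j y).
  by split; [apply: jMg gy | rewrite -linB // ey linZ].
exists c => //; exists d, M, x; do 2!split=> //; move=> k.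
by have [gx [dx _]] := xP k.
Qed.

(** Linearity sends the error [pi ^+ k *: y] to a multiple of [pi ^+ k], so [psi c] and [z] both
    agree with the approximating term modulo [pi ^+ k]. This gives uniqueness and also the values of
    [phi]. *)
Lemma approx_hat (psi : C -> nat -> A) z c :
  (forall x, hat_eq pi (psi (j x)) (hat_of x)) ->
  (forall c1 c2, hat_eq pi (psi (c1 + c2)) (fun k => psi c1 k + psi c2 k)) ->
  (forall a c, hat_eq pi (psi (a *: c)) (fun k => a *: psi c k)) ->
  approx z c -> hat_eq pi (psi c) z.
Proof.
move=> psij psiD psiZ [d [N [x [BN [Nsub xP]]]]] k.
have [_ [dx [y [Ny ey]]]] := xP k.
apply: pdiv_trans (pdivC dx); rewrite -(subrK (j (x k)) c) ey.
apply: pdiv_trans (psiD _ _ k) _.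
apply: pdiv_trans (pdiv_addr (psiZ _ _ k) (psij _ k)) _.
by rewrite addrK; apply: pdiv_scale.
Qed.

End Approximation.

(** * The universal map and its inverse *)

Section Isomorphism.

Variables (V : idomainType) (pi : V) (A : comAlgType V) (l : seq A).
Variables (C : algType V) (BC : pset (pset C)) (j : A -> C).
Hypotheses (pi_dvr : forall c : V, c \is a GRing.unit \/ exists c', c = pi * c')
  (gen : generates l) (BC_alg : is_alg_bornology BC) (j_hom : rhom j)
  (j_completion : is_completion pi (growth_born pi l) BC j).

Let BC_born : is_bornology BC. Proof. by case: j_completion. Qed.
Let BC_complete : complete_born pi BC. Proof. by case: j_completion => _ []. Qed.
Let j_lin : lin j. Proof. by case: j_completion => _ [_ []]. Qed.
Let j_bounded : bounded_map (growth_born pi l) BC j.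
Proof. by case: j_completion => _ [_ [_ []]]. Qed.

Local Notation approx := (approx pi l BC j).
Local Notation dagger := (@dagger V pi A l).

Lemma approx_inverse : exists h : dagger -> C, lin h /\
  bounded_map (@dag_born V pi A l) BC h /\
  (forall x, h (dag_of pi gen x) = j x) /\
  forall x, approx (dval x) (h x).
Proof.
have inj := approx_inj pi_dvr gen BC_alg BC_complete j_lin j_bounded.
have ex := approx_ex BC_complete j_lin j_bounded.
have /boolp.choice[h hP] : forall x : dagger, exists c, approx (dval x) c.
  by move=> x; have [d /= xd] := dval_rep x; have [M _ /(_ _ xd)[c]] := ex d; exists c.
exists h; split.
  split=> [x y | a x].
    apply: (inj _ _ _ _ _ (hP _) (approxD BC_alg j_lin (hP x) (hP y))).
    exact: dvalD.
  apply: (inj _ _ _ _ _ (hP _) (approxZ j_lin a (hP x))).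
  exact: dvalZ.
split.
  move=> S [d Sd]; have [M BM exM] := ex d; have [_ [Bsub _]] := BC_born.
  apply: Bsub BM _ => _ [x [/Sd xd ->]]; have [c Mc xc] := exM _ xd.
  by rewrite (inj _ _ _ _ (hat_eqxx pi _) (hP x) xc).
split=> // x; apply: inj (dval_of pi gen x) (hP _) _.
have [d xd] := deg_le_ex x gen.
(* The constant sequence approximates with zero error, so the zero submodule suffices. *)
exists d, (fun c => c = 0), (hat_of x); split.
  by have [Bfin [Bsub _]] := BC_born; apply: Bsub (Bfin [:: 0]) _ => c ->; rewrite inE.
split=> [|k]; first exact: submod_eq0.
split; first by apply: growth_deg xd; rewrite muln1.
by rewrite !subrr; split; [apply: pdiv0 | exists 0; rewrite scaler0].
Qed.

Lemma dagger_iso : exists phi : C -> nat -> A,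
  MW_iso pi BC j phi /\
  forall psi : C -> nat -> A, MW_iso pi BC j psi ->
    forall c, hat_eq pi (psi c) (phi c).
Proof.
have inj := approx_inj pi_dvr gen BC_alg BC_complete j_lin j_bounded.
have ex := approx_ex BC_complete j_lin j_bounded.
have [_ [_ [_ [_ univ]]]] := j_completion.
have [g [g_lin [g_bounded [gj _]]]] := univ dagger _ (@dag_born_bornology V pi A l)
  (@dag_born_complete V pi A l) _
  (@dag_of_lin V pi A l gen) (@dag_of_bounded V pi A l gen).
have [h [h_lin [h_bounded [hj hP]]]] := approx_inverse.
(* Both [h \o g] and the identity extend [j], so uniqueness in the universal property of [C]
   identifies them. *)
have hg c : h (g c) = c.
  have [k [_ [_ [_ kuniq]]]] := univ C BC BC_born BC_complete j j_lin j_bounded.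
  have bounded_id S T : BC S -> (forall x, T x -> S x) -> BC T.
    by case: BC_born => _ [Bsub _] BS; apply: Bsub.
  transitivity (k c); [apply: (kuniq (h \o g)) | symmetry; apply: (kuniq id)] => //=.
  - by split=> [x y | a x] /=; rewrite ?(linD, linZ).
  - move=> S /g_bounded/h_bounded BS; apply: bounded_id BS _ => _ [x [Sx ->]].
    by exists (g x); split=> //; exists x.
  - by move=> x; rewrite gj hj.
  by move=> S BS; apply: bounded_id BS _ => _ [x [Sx ->]].
pose phi c := dval (g c).
have phiP c : approx (phi c) c by rewrite -[X in approx _ X]hg; apply: hP.
have phij x : hat_eq pi (phi (j x)) (hat_of x) by rewrite /phi gj; apply: dval_of.
have phiD c1 c2 : hat_eq pi (phi (c1 + c2)) (fun k => phi c1 k + phi c2 k).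
  by rewrite /phi linD //; apply: dvalD.
have phiZ a c : hat_eq pi (phi (a *: c)) (fun k => a *: phi c k).
  by rewrite /phi linZ //; apply: dvalZ.
have phi_eq z c : approx z c -> hat_eq pi (phi c) z by apply: approx_hat.
have in_MW_ex z : in_MW pi z -> exists c, hat_eq pi (phi c) z.
  case/(in_MWP pi gen) => d zd; have [M _ /(_ _ zd)[c _ zc]] := ex d.
  by exists c; apply: phi_eq.
exists phi; split; last first.
  move=> psi [_ [psij [psiD [psiZ _]]]] c.
  exact: approx_hat psij psiD psiZ (phiP c).
split; first by move=> c; apply/(in_MWP pi gen)/dval_rep.
do 3!split=> //; split.
  (* The universal property only makes [g] linear; multiplicativity comes from products of
     approximations. *)
  by move=> c1 c2; apply: phi_eq; apply: approxM.
split; first by have [<- _] := j_hom; apply: phij.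
split; first by move=> c1 c2 /inj; apply.
split=> //; split=> [S /g_bounded[d Sd] | S /(MW_boundedP pi gen)[d Sd]].
  apply/(MW_boundedP pi gen); exists d => _ [c [Sc ->]].
  by apply: Sd; exists c.
have [M BM exM] := ex d; have [_ [Bsub _]] := BC_born.
apply: Bsub BM _ => c [z [/Sd/exM[c' Mc' zc'] cz]].
by rewrite (inj _ _ _ _ cz (phiP c) zc').
Qed.

End Isomorphism.

Theorem mainTheorem3 (V : idomainType) (pi : V) (eps : R)
  (A : comAlgType V) (C : algType V) (BC : pset (pset C)) (j : A -> C) :
  is_cdvr pi -> Rlt R0 eps -> Rlt eps R1 ->
  fg_alg A ->
  is_alg_bornology BC -> rhom j ->
  is_completion pi (lg_born pi eps (@fine V A)) BC j ->
  exists phi : C -> nat -> A,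
    MW_iso pi BC j phi /\
    (forall psi : C -> nat -> A, MW_iso pi BC j psi ->
       forall c, hat_eq pi (psi c) (phi c)).
Proof.
move=> /dvr_cases pi_dvr eps_gt0 eps_lt1 [l gen] BC_alg j_hom.
have -> : lg_born pi eps (@fine V A) = growth_born pi l.
  by apply/boolp.funext => S; apply/boolp.propext/lg_bornP.
exact: dagger_iso pi_dvr gen BC_alg j_hom.
Qed.
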